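(* Let $X$ be a Tychonoff space and let $\aleph_\alpha\geq\aleph_1$ be a cardinal. Then $\psi(C_{\aleph_\alpha}(X))=ac_{\aleph_\alpha}(X)$.
   Context: Tychonoff means completely regular and Hausdorff. $C(X)$ is the set of all real-valued continuous functions on $X$. For an infinite cardinal $\aleph_\alpha$, $\mathcal{A}_{\aleph_\alpha}=\{A\subseteq X: |A|<\aleph_\alpha\}$. For $f\in C(X)$, $A\in\mathcal{A}_{\aleph_\alpha}$ and real $\epsilon>0$ put $B(f,A,\epsilon)=\{g\in C(X): \sup_{x\in A}|f(x)-g(x)|<\epsilon\}$ (equal to $C(X)$ when $A=\emptyset$). The sets $B(f,A,\epsilon)$ form a base of a topology on $C(X)$; $C_{\aleph_\alpha}(X)$ denotes $C(X)$ with this topology. A family $\mathcal{B}\subseteq\mathcal{A}_{\aleph_\alpha}$ is an almost-$\aleph_\alpha$-cover of $X$ if $\overline{\bigcup\mathcal{B}}=X$, and $ac_{\aleph_\alpha}(X)=\aleph_0+\min\{|\mathcal{B}|: \mathcal{B}\text{ is an almost-}\aleph_\alpha\text{-cover of }X\}$. For a space $Y$ and $y\in Y$, $\psi(y,Y)=\aleph_0+\min\{|\mathcal{U}|: \mathcal{U}\text{ is a family of open sets in }Y\text{ with }\bigcap\mathcal{U}=\{y\}\}$ and the pseudocharacter is $\psi(Y)=\sup\{\psi(y,Y): y\in Y\}$. *)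

(* Defs.v *)
From HB Require Import structures.
From mathcomp Require Import all_boot all_order all_algebra.
From mathcomp Require Import all_classical all_reals all_analysis.
Import Order.TTheory GRing.Theory Num.Theory.
Import numFieldNormedType.Exports.

Set Implicit Arguments.
Unset Strict Implicit.
Unset Printing Implicit Defensive.

Local Open Scope classical_set_scope.
Local Open Scope card_scope.
Local Open Scope ring_scope.

(* Cardinals are represented by types, taken up to equipotence: a type K stands
   for the cardinal of [set: K], two cardinals are compared by #<= and their
   equality is #=.  The sum of two cardinals is the disjoint sum of types. *)

Definition card_lt T U (A : set T) (B : set U) : bool :=
  (A #<= B) && ~~ (B #<= A).

Lemma card_leTP T U : 
  [set: T] #<= [set: U] <-> exists f : T -> U, injective f.
Proof.
split.
  move=> /card_leP/injfunPex[f _ fi].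
  exists (fun x => val (f (SigSub (mem_set (I : [set: T] x))))) => x y /val_inj e.
  have /(congr1 val) := fi _ _ (mem_set I) (mem_set I) e.
  by [].
move=> [f fi]; apply/card_leP/injfunPex.
exists (fun x => SigSub (mem_set (I : [set: U] (f (val x))))) => // x y _ _.
by move=> /(congr1 val) /= /fi /val_inj.
Qed.

Lemma ex_card_min (I : Type) (i0 : I) (F : I -> Type) :
  exists i, forall j, [set: F i] #<= [set: F j].
Proof.
pose P (M : set (forall i, F i)) :=
  forall a b i, M a -> M b -> a i = b i -> a = b.
have [|M [PM Mmax]] := @Zorn_bigcup _ P.
  move=> G GP totG a b i [A GA Aa] [B GB Bb] ab.
  have [/(_ a Aa) Ba|/(_ b Bb) Ab] := totG A B GA GB.
    exact: (GP B GB a b i).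
  exact: (GP A GA a b i).
have [[i iP]|nP] := pselect (exists i, forall x : F i, exists2 a, M a & a i = x).
  exists i => j; apply/card_leTP.
  have /choice[s sP] : forall x : F i, exists a, M a /\ a i = x.
    by move=> x; have [a] := iP x; exists a.
  exists (fun x => s x j) => x y /PM e.
  rewrite -(sP x).2 -(sP y).2; congr (_ i).
  by apply: e; [exact: (sP x).1|exact: (sP y).1].
have H i : {x : F i | forall a, M a -> a i <> x}.
  apply: cid; apply: contrapT => /forallNP H; apply: nP; exists i => x.
  have /existsNP[a /not_implyP[Ma /contrapT ax]] := H x.
  by exists a.
pose c i := projT1 (H i).
have cP i a : M a -> a i <> c i by move=> Ma; exact: (projT2 (H i)).
exfalso; apply: (Mmax (M `|` [set c])).
  split; first by left.
  by move=> /(_ c) H'; apply: (@cP i0 c) => //; apply: H'; right.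
move=> a b i [Ma|->] [Mb|->] // e.
- exact: PM e.
- by case: (cP i a Ma).
- by case: (cP i b Mb).
Qed.

Lemma card_le_total (T U : Type) (A : set T) (B : set U) :
  A #<= B \/ B #<= A.
Proof.
have [[] /=] := ex_card_min true (fun b : bool => if b then set_type A else set_type B).
  by move=> /(_ false) /=; rewrite (card_le_eql (card_setT _)) (card_le_eqr (card_setT _)); left.
by move=> /(_ true) /=; rewrite (card_le_eql (card_setT _)) (card_le_eqr (card_setT _)); right.
Qed.

Lemma card_ltNge (T U : Type) (A : set T) (B : set U) :
  card_lt A B = ~~ (B #<= A).
Proof.
rewrite /card_lt; case: (boolP (B #<= A)); rewrite ?andbF ?andbT // => /negP nBA.
by have [] := card_le_total A B.
Qed.

Definition is_cardmin (P : Type -> Prop) (K : Type) : Prop :=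
  P K /\ forall L : Type, P L -> [set: K] #<= [set: L].

(* A least cardinal satisfying P; cardminP below shows that it exists as soon
   as P has a witness, so the defaullem.value void is used only for an empty P. *)
Definition cardmin (P : Type -> Prop) : Type :=
  if pselect (exists K, is_cardmin P K) is left h then projT1 (cid h) else void.

Lemma cardminP (P : Type -> Prop) : (exists K, P K) -> is_cardmin P (cardmin P).
Proof.
move=> [A PA].
suff ex : exists K, is_cardmin P K.
  by rewrite /cardmin; case: pselect => // h; case: (cid h).
pose I := {S : set A | exists L, P L /\ S #= [set: L]}.
have i0 : I by exists setT, A; split=> //; exact: card_eqxx.
have [[S [K [PK SK]]] /= Smin] := ex_card_min i0 (fun i => set_type (projT1 i)).
exists K; split => // L PL.
have SleL (Q : set A) : Q #= [set: L] -> S #<= [set: L].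
  move=> QL.
  have /= := Smin (exist _ Q (ex_intro _ L (conj PL QL))).
  by rewrite (card_le_eql (card_setT _)) (card_le_eqr (card_setT _)) (card_le_eqr QL).
rewrite -(card_le_eql SK).
have [AL|LA] := card_le_total [set: A] [set: L].
  exact: card_le_trans (card_leT _) AL.
have /card_leTP[f fi] := LA.
apply: (SleL (range f)); apply: inj_card_eq; exact: in2W.
Qed.

Definition cardsup (I : Type) (F : I -> Type) : Type :=
  cardmin (fun K => forall i, [set: F i] #<= [set: K]).

Lemma cardsupP (I : Type) (F : I -> Type) :
  is_cardmin (fun K => forall i, [set: F i] #<= [set: K]) (cardsup F).
Proof.
apply: cardminP; exists {i & F i} => i; apply/card_leTP.
by exists (existT F i) => x y; exact: (@existT_inj2 {classic I} F i).
Qed.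

Lemma card_double (T : Type) : infinite_set [set: T] ->
  [set: T + T] #<= [set: T].
Proof.
move=> infT.
have [E [ED tE Emax]] := ex_maximal_disjoint_subcollection
  (fun e : nat -> T => range e) [set e | injective e].
pose R := ~` \bigcup_(e in E) range e.
have finR : finite_set R.
  apply: contrapT => /infiniteP; rewrite -(card_le_eqr (card_setT R)).
  move=> /card_leTP[g gi]; pose h n := val (g n).
  have hR n : R (h n) by exact: set_valP.
  apply: (Emax (E `|` [set h])).
  - split; first by left.
    move=> /(_ h (or_intror erefl)) Eh; apply: (hR 0%N).
    by exists h => //; exists 0%N.
  - by move=> e [/ED//|->] x y /val_inj /gi.
  - move=> e f [Ee|->] [Ef|->] //; first exact: tE.
    + by move=> [z [ez [n _ hn]]]; case: (hR n); exists e => //; rewrite hn.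
    + by move=> [z [[n _ hn] fz]]; case: (hR n); exists f => //; rewrite hn.
have [e0 Ee0] : E !=set0.
  apply/set0P/negP => /eqP E0; apply: infT.
  by move: finR; rewrite /R E0 bigcup_set0 setC0.
have : countable (range e0 `|` R).
  rewrite -bigcup2E; apply: bigcup_countable => // -[|[|n]] _ /=.
  - exact: card_image_le.
  - exact: finite_set_countable.
  - exact: countable0.
move=> /pfcard_geP[R0|[g]].
  have : (range e0 `|` R) (e0 0%N) by left; exists 0%N.
  by rewrite R0.
pose e' (e : nat -> T) := if pselect (e = e0) then g : nat -> T else e.
have cover t : exists en : (nat -> T) * nat, E en.1 /\ e' en.1 en.2 = t.
  have [gt|gt] := pselect ((range e0 `|` R) t).
    have [n _ gn] := 'surj_g gt.
    by exists (e0, n); split => //=; rewrite /e'; case: pselect.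
  have [e Ee [n _ en]] : (\bigcup_(e in E) range e) t.
    by apply: contrapT => H; apply: gt; right.
  exists (e, n); split => //=; rewrite /e'; case: pselect => // ee0.
  by exfalso; apply: gt; left; rewrite -ee0; exists n.
have /choice[s sP] := cover.
pose F (z : T + T) := match z with
  | inl t => (s t).1 (s t).2.*2 | inr t => (s t).1 (s t).2.*2.+1 end.
have FE t u m n : (s t).1 m = (s u).1 n -> (s t).1 = (s u).1 /\ m = n.
  move=> e; have est : (s t).1 = (s u).1.
    apply: tE; [exact: (sP t).1|exact: (sP u).1|].
    by exists ((s t).1 m); split; [exists m|exists n].
  by split => //; rewrite est in e; exact: (ED _ (sP u).1 _ _ e).
have sinj t u : (s t).1 = (s u).1 -> (s t).2 = (s u).2 -> t = u.
  by move=> e1 e2; rewrite -(sP t).2 -(sP u).2 e1 e2.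
apply/card_leTP; exists F => -[t|t] [u|u] /= /FE[e1].
- by move=> /double_inj /(sinj _ _ e1) ->.
- by move=> /(congr1 odd); rewrite /= !odd_double.
- by move=> /(congr1 odd); rewrite /= !odd_double.
- by move=> [/double_inj] /(sinj _ _ e1) ->.
Qed.

Lemma card_lt_setU (K T : Type) (A B : set T) : infinite_set [set: K] ->
  card_lt A [set: K] -> card_lt B [set: K] -> card_lt (A `|` B) [set: K].
Proof.
move=> Kinf.
wlog AB : A B / A #<= B.
  move=> H ? ?; have [AB|BA] := card_le_total A B; first exact: H.
  by rewrite setUC; exact: H.
move=> Alt; have [finB|infB] := pselect (finite_set B).
  rewrite !card_ltNge => _; apply/negP => /card_le_finite Kfin; apply/Kinf/Kfin.
  by rewrite finite_setU; split => //; exact: card_le_finite AB _.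
rewrite !card_ltNge; apply: contraNN => KAB; apply: card_le_trans KAB _.
have infB' : infinite_set [set: set_type B] by rewrite (eq_finite_set (card_setT B)).
rewrite -(card_le_eqr (card_setT B)); apply: card_le_trans (card_double infB').
move: AB; rewrite -(card_le_eql (card_setT A)) -(card_le_eqr (card_setT B)).
move=> /card_leTP[f fi]; rewrite -(card_le_eql (card_setT _)).
apply/card_leTP.
have H (x : set_type (A `|` B)) : ~ (val x \in A) -> val x \in B.
  move=> nA; case: x nA => x /= xAB /negP nA; move: xAB; rewrite in_setU (negbTE nA)//.
exists (fun x => match pselect (val x \in A) with
  | left h => inl (f (SigSub h)) | right h => inr (SigSub (H x h)) end).
move=> x y; do 2 case: pselect => ? //.
  by move=> [] /fi [] /val_inj.
by move=> [] /val_inj.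
Qed.

Definition aleph0 : Type := nat.

Definition aleph1 : Type := cardmin (fun K => card_lt [set: aleph0] [set: K]).

Definition pseudocharacter_at (Y : topologicalType) (y : Y) : Type :=
  (aleph0 + cardmin (fun K => exists U : set (set Y),
    [/\ U `<=` open, \bigcap_(V in U) V = [set y] & [set: K] #= U]))%type.

Definition pseudocharacter (Y : topologicalType) : Type :=
  cardsup (@pseudocharacter_at Y).

Definition almost_cover (kappa : Type) (X : topologicalType)
    (B : set (set X)) : Prop :=
  (forall A, B A -> card_lt A [set: kappa]) /\
  closure (\bigcup_(A in B) A) = [set: X].

Definition ac (kappa : Type) (X : topologicalType) : Type :=
  (aleph0 + cardmin (fun K => exists B : set (set X),
    almost_cover kappa B /\ [set: K] #= B))%type.

Definition tychonoff_space (X : topologicalType) : Prop :=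
  completely_regular_space X /\ hausdorff_space X.

(* A copy of continuousType X R, which the library already equips with other
   topologies. *)
Definition Cspace (R : realType) (kappa : Type) (X : topologicalType) : Type :=
  continuousType X R.

Section Cspace_topology.
Context (R : realType) (kappa : Type) (X : topologicalType).
Local Notation C := (Cspace R kappa X).

HB.instance Definition _ := Choice.copy C (continuousType X R).

(* The supremum is taken in \bar R: it is -oo when A is empty, so that the ball
   is then the whole space, and +oo when f - g is unbounded on A. *)
Definition Cball (f : continuousType X R) (A : set X) (eps : R) :
    set (continuousType X R) :=
  [set g | (ereal_sup [set `|f x - g x|%:E | x in A] < eps%:E)%E].

Definition Cballs : set (set C) :=
  [set U | exists f A eps,
    [/\ card_lt A [set: kappa], 0 < eps & U = Cball f A eps]].

(* The topology generated by the balls; for infinite kappa they form a base of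
   it, see Cspace_openP. *)
HB.instance Definition _ := @isSubBaseTopological.Build C (set C) Cballs id.

Lemma CballP f A eps g : Cball f A eps g <->
  exists2 r, r < eps & forall x, A x -> `|f x - g x| <= r.
Proof.
rewrite /Cball /=; split; last first.
  move=> [r re fg]; apply: (@le_lt_trans _ _ r%:E); last by rewrite lte_fin.
  by apply: ge_ereal_sup => _ [x Ax <-]; rewrite lee_fin; exact: fg.
have ub x : A x ->
    (`|f x - g x|%:E <= ereal_sup [set `|f x - g x|%:E | x in A])%E.
  by move=> Ax; apply: ereal_sup_ubound; exists x.
case: ereal_sup ub => [r|//|] ub; first by rewrite lte_fin => re; exists r.
move=> _; exists (eps - 1); first by rewrite ltrBlDr ltrDl.
by move=> x /ub; rewrite leNgt ltNyr.
Qed.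

Lemma Cball_center f A eps : 0 < eps -> Cball f A eps f.
Proof. by move=> e0; apply/CballP; exists 0 => // x _; rewrite subrr normr0. Qed.

Lemma Cball_sub f A B eps del :
  B `<=` A -> eps <= del -> Cball f A eps `<=` Cball f B del.
Proof.
move=> BA ed g /CballP[r re fg]; apply/CballP.
by exists r => [|x /BA]; [exact: lt_le_trans re ed|exact: fg].
Qed.

Lemma Cball_shift f A eps g : Cball f A eps g ->
  exists2 del, 0 < del & Cball g A del `<=` Cball f A eps.
Proof.
move=> /CballP[r re fg]; exists (eps - r); first by rewrite subr_gt0.
move=> h /CballP[s se gh]; apply/CballP; exists (r + s).
  by rewrite -ltrBrDl.
move=> x Ax; apply: (le_trans (ler_distD (g x) _ _)).
by rewrite lerD ?fg ?gh.
Qed.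

Lemma open_Cball f A eps :
  card_lt A [set: kappa] -> 0 < eps -> open (Cball f A eps : set C).
Proof.
move=> Ak e0; exists [set (Cball f A eps : set C)]; last by rewrite bigcup_set1.
by move=> _ ->; apply: (@finI_from1 _ _ _ id); exists f, A, eps.
Qed.

Lemma Cspace_openP : infinite_set [set: kappa] -> forall U : set C,
  open U <-> forall f, U f -> exists A eps,
    [/\ card_lt A [set: kappa], 0 < eps & Cball f A eps `<=` U].
Proof.
move=> kinf U; split; last first.
  move=> H; rewrite openE => f /H[A [eps [Ak e0 sub]]].
  rewrite /interior nbhsE; exists (Cball f A eps) => //.
  by split; [exact: open_Cball|exact: Cball_center].
move=> [D sD <-] f [V DV Vf].
pose F : set_system C := [set V | exists A eps,
  [/\ card_lt A [set: kappa], 0 < eps & Cball f A eps `<=` V]].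
have FF : Filter F.
  split.
  - exists set0, 1; split => //; rewrite card_ltNge card_le0.
    by apply/negP => /eqP k0; apply: kinf; rewrite k0.
  - move=> P Q [A [e [Ak e0 sP]]] [B [d [Bk d0 sQ]]].
    exists (A `|` B), (Num.min e d); split.
    + exact: card_lt_setU.
    + by rewrite lt_min e0.
    + move=> g fg; split; [apply: sP|apply: sQ].
        by apply: Cball_sub fg; [exact: subsetUl|rewrite ge_min lexx].
      by apply: Cball_sub fg; [exact: subsetUr|rewrite ge_min lexx orbT].
  - move=> P Q PQ [A [e [Ak e0 sP]]]; exists A, e; split => //.
    exact: subset_trans PQ.
suff : F (\bigcup_(V in D) V) by [].
apply: (@filterS _ _ _ V); first by move=> g Vg; exists V.
have [E sE EV] := sD _ DV; rewrite -EV; apply: filter_bigI => W WE.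
have := sE _ WE; rewrite inE => -[g [A [eps [Ak e0 We]]]].
have : W f by move: Vf; rewrite -EV; exact.
rewrite We => /Cball_shift[del d0 sub].
by exists A, del.
Qed.

End Cspace_topology.

(* Main.v *)
(* Evaluating the pseudocharacter at a point [f]: given an almost cover [B], the
   balls [B(f, A, 1/n)] with [A] in [B] meet only in [f], because a continuous
   function that agrees with [f] on a dense set is [f]. Conversely, if open sets
   [U] meet only in [f], pick [B(f, A_U, eps_U)] inside each of them; were the
   union of the [A_U] not dense, complete regularity would give a nonzero
   continuous [h] vanishing on it, and [f + h] would lie in every [U]. *)
Require Import Defs.
From mathcomp Require Import all_boot all_order all_algebra.
From mathcomp Require Import all_classical all_reals all_analysis.
Import numFieldNormedType.Exports.
Local Open Scope classical_set_scope.
Local Open Scope card_scope.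
Import Order.TTheory GRing.Theory Num.Theory.

(* An injection [T + T -> T] is a pair of injections [l], [r] with disjoint
   ranges, so that [(t, n) |-> r^n (l t)] is injective. *)
Lemma card_mul_nat (T : Type) : infinite_set [set: T] ->
  [set: T * nat] #<= [set: T].
Proof.
move=> /card_double/card_leTP[F Finj]; apply/card_leTP.
have rinj : injective (F \o inr) by move=> x y /Finj[].
exists (fun p => iter p.2 (F \o inr) (F (inl p.1))) => -[x m] [y n] /=.
elim: m n => [|m IHm] [|n] /=.
- by move=> /Finj[->].
- by move=> /Finj.
- by move=> /Finj.
- by move=> /rinj /IHm[-> ->].
Qed.

Lemma infinite_aleph0_sum (K : Type) : infinite_set [set: aleph0 + K].
Proof. by apply/infiniteP/card_leTP; exists inl => x y []. Qed.

(** The summand [aleph0] makes the right side infinite even when [K] is finite. This absorbs the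
    index [n] of the radii attached to each member of a cover. *)
Lemma card_aleph0_sum_mul_nat (K : Type) :
  [set: K * nat] #<= [set: aleph0 + K].
Proof.
apply: card_le_trans (card_mul_nat _ (infinite_aleph0_sum K)).
by apply/card_leTP; exists (fun p => (inr p.1, p.2)) => -[x m] [y n] [-> ->].
Qed.

(** Sending the two summands into separate copies of [aleph0 + L] reduces this to doubling an
    infinite cardinal. *)
Lemma card_aleph0_sum_le (K L : Type) : [set: K] #<= [set: aleph0 + L] ->
  [set: aleph0 + K] #<= [set: aleph0 + L].
Proof.
move=> /card_leTP[f finj].
apply: card_le_trans (card_double (infinite_aleph0_sum L)).
apply/card_leTP; exists (fun z => match z with
  | inl n => inl (inl n) | inr k => inr (f k) end).
by move=> [m|x] [n|y] // [] => [->|/finj ->].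
Qed.

Lemma card_set1_lt (T K : Type) (x : T) : infinite_set [set: K] ->
  card_lt [set x] [set: K].
Proof.
move=> Kinf; rewrite card_ltNge; apply/negP => /card_le_finite Kfin.
exact/Kinf/Kfin/finite_set1.
Qed.

Lemma infinite_ge_aleph1 (K : Type) : [set: aleph1] #<= [set: K] ->
  infinite_set [set: K].
Proof.
move=> /card_le_finite aleph1_fin /aleph1_fin.
have [|+ _] := @cardminP (fun K => card_lt [set: aleph0] [set: K]).
  (* Cantor's theorem shows that [aleph1] is a minimum over a nonempty class; [D] is the diagonal
     set for an injection [f] of the power set. *)
  exists (set aleph0); rewrite card_ltNge; apply/negP => /card_leTP[f finj].
  pose D := [set n | exists2 A, f A = n & ~ A n].
  have [DfD|nDfD] := pselect (D (f D)); last by apply: (nDfD); exists D.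
  by have [A /finj AD] := DfD; rewrite AD.
by move=> /andP[/infiniteP].
Qed.

Section Cspace.
Context (R : realType) (X : topologicalType) (kappa : Type).
Hypothesis kappa_infinite : infinite_set [set: kappa].
Local Notation C := (Cspace R kappa X).
Local Open Scope ring_scope.

(** The singletons cover [X]; hence the [cardmin] inside [ac] is a true minimum and not the default
    [void]. *)
Lemma ex_almost_cover : exists B : set (set X), almost_cover kappa B.
Proof.
exists (range set1); split.
  by move=> _ [x _ <-]; exact: card_set1_lt.
apply/seteqP; split=> // x _; apply: subset_closure.
by exists [set x].
Qed.

Lemma continuous_eq_dense (D : set X) (f g : continuousType X R) :
  closure D = [set: X] -> (forall x, D x -> f x = g x) -> f = g.
Proof.
move=> DX fg; apply/continuousEP => x.
have cfg : continuous (fun x => f x - g x).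
  by move=> y; apply: cvgB; exact: cts_fun.
have : closed ((fun x => f x - g x) @^-1` [set 0]).
  by move/continuous_closedP: cfg; apply; exact: closed_eq.
move=> /closure_id E; apply/eqP; rewrite -subr_eq0; apply/eqP.
have : closure D x by rewrite DX.
suff sub : D `<=` (fun x => f x - g x) @^-1` [set 0].
  by move=> /(closureS sub); rewrite -E.
by move=> y /fg /= ->; rewrite subrr.
Qed.

Lemma almost_cover_pseudobase (B : set (set X)) (f : C) :
  almost_cover kappa B ->
  exists U : set (set C), [/\ U `<=` open, \bigcap_(V in U) V = [set f] &
    U #<= [set: set_type B * nat]].
Proof.
move=> [Bk BX].
pose V (p : set_type B * nat) : set C := Cball f (val p.1) p.2.+1%:R^-1.
exists (range V); split.
- move=> _ [[A n] _ <-]; apply: open_Cball; last by rewrite invr_gt0.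
  exact: Bk (set_valP A).
- apply/seteqP; split=> [g gV|_ -> _ [p _ <-]]; last first.
    by apply: Cball_center; rewrite invr_gt0.
  apply: (@continuous_eq_dense _ g f BX) => x [A BA Ax].
  apply/eqP; rewrite eq_sym -subr_eq0 -normr_le0; apply/ler_addgt0Pr => e e0.
  have [n ne] : exists n, n.+1%:R^-1 < e.
    (* Truncation rounds down, so its successor exceeds [e^-1]. *)
    by exists (Num.truncn e^-1); rewrite invf_plt ?posrE ?truncnS_gt.
  have /CballP[r re /(_ _ Ax)] := gV _ (imageT V (SigSub (mem_set BA), n)).
  by rewrite add0r => /le_trans; apply; exact/ltW/lt_trans/ne.
- exact: card_image_le.
Qed.

Lemma pseudobase_almost_cover (U : set (set C)) (f : C) :
  completely_regular_space X -> U `<=` open -> \bigcap_(V in U) V = [set f] ->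
  exists2 B : set (set X), almost_cover kappa B & B #<= U.
Proof.
move=> crX Uopen Uf.
(* Choice needs a value at every [V]; outside [U] it is the dummy [set0]. *)
have /choice[A AP] : forall V : set C, exists A : set X, U V ->
    card_lt A [set: kappa] /\ exists2 eps : R, 0 < eps & Cball f A eps `<=` V.
  move=> V; have [UV|nUV] := pselect (U V); last by exists set0.
  have Vf : V f by move: UV; apply: (_ : (\bigcap_(V in U) V) f); rewrite Uf.
  have /(_ f Vf)[A [eps [Ak e0 sub]]] :=
    (Cspace_openP kappa_infinite V).1 (Uopen _ UV).
  by exists A => _; split=> //; exists eps.
exists (A @` U); last exact: card_image_le.
split; first by move=> _ [V UV <-]; exact: (AP V UV).1.
apply/seteqP; split=> // x _; apply: contrapT => nx.
have /(uniform_separatorP (R := R))[h [ch _ hx hA]] :=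
  crX _ _ (@closed_closure _ _) nx.
(* [h] is 0 at [x] and 1 on the closure of the union, so the bump [1 - h] alters [f] at [x] but
   nowhere on the sets [A V]. *)
pose k y := f y + (1 - h y).
have ck : continuous k.
  move=> y; apply: cvgD; first exact: (@cts_fun _ _ (f : continuousType X R)).
  by apply: cvgB; [exact: cvg_cst|exact: ch].
pose g : continuousType X R := mkcts ck.
have : (\bigcap_(V in U) V) g.
  move=> V UV; have [_ [eps e0]] := AP V UV; apply; apply/CballP.
  exists 0 => // y Ay.
  have -> : g y = f y; last by rewrite subrr normr0.
  have hy : h y = 1.
    apply: hA; exists y => //; apply: subset_closure.
    by exists (A V) => //; exists V.
  by rewrite (_ : g y = k y) // /k hy subrr addr0.
rewrite Uf => /= gf; have : k x = f x by rewrite -gf.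
have hx0 : h x = 0 by apply: hx; exists x.
move=> /(canRL (addKr _)); rewrite hx0 subr0 addNr => /eqP.
by rewrite oner_eq0.
Qed.

Lemma card_pseudocharacter_at_le (f : C) :
  [set: @pseudocharacter_at C f] #<= [set: ac kappa X].
Proof.
apply: card_aleph0_sum_le.
have [B0 B0P] := ex_almost_cover.
have [|[B [BP KB]] _] := @cardminP (fun K => exists B : set (set X),
    almost_cover kappa B /\ [set: K] #= B).
  by exists (set_type B0), B0; split => //; exact: card_setT.
have [U [Uo Uf UB]] := almost_cover_pseudobase _ f BP.
have PU : exists U0 : set (set C), [/\ U0 `<=` open,
    \bigcap_(V in U0) V = [set f] & [set: set_type U] #= U0].
  by exists U; split => //; exact: card_setT.
have [|_ /(_ _ PU)/card_le_trans] := @cardminP (fun K =>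
    exists U : set (set C),
    [/\ U `<=` open, \bigcap_(V in U) V = [set f] & [set: K] #= U]).
  by exists (set_type U).
apply; rewrite (card_le_eql (card_setT U)); apply: card_le_trans UB _.
apply: card_le_trans (card_aleph0_sum_mul_nat _).
have := KB; rewrite card_eq_sym -(card_eql (card_setT B)).
move=> /card_eqPle[/card_leTP[i iinj] _]; apply/card_leTP.
by exists (fun p => (i p.1, p.2)) => -[a m] [b n] [/iinj -> ->].
Qed.

Lemma card_ac_le (f : C) : completely_regular_space X ->
  [set: ac kappa X] #<= [set: @pseudocharacter_at C f].
Proof.
move=> crX; apply: card_aleph0_sum_le.
have [B0 B0P] := ex_almost_cover.
(* [U0] witnesses that the minimum defining the pseudocharacter at [f] is attained. *)
have [U0 [U0o U0f _]] := almost_cover_pseudobase _ f B0P.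
have [|[U [Uo Uf KU]] _] := @cardminP (fun K => exists U : set (set C),
    [/\ U `<=` open, \bigcap_(V in U) V = [set f] & [set: K] #= U]).
  by exists (set_type U0), U0; split => //; exact: card_setT.
have [B BP BU] := pseudobase_almost_cover _ _ crX Uo Uf.
have PB : exists B0 : set (set X), almost_cover kappa B0 /\
    [set: set_type B] #= B0.
  by exists B; split => //; exact: card_setT.
have [|_ /(_ _ PB)/card_le_trans] := @cardminP (fun K =>
    exists B : set (set X), almost_cover kappa B /\ [set: K] #= B).
  by exists (set_type B).
apply; rewrite (card_le_eql (card_setT B)); apply: card_le_trans BU _.
rewrite -(card_le_eql KU); apply/card_leTP.
by exists inr => x y [].
Qed.

End Cspace.

Theorem theorem5p13 (R : realType) (X : topologicalType) (kappa : Type) :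
  tychonoff_space X ->
  [set: aleph1] #<= [set: kappa] ->
  [set: pseudocharacter (Cspace R kappa X)] #= [set: ac kappa X].
Proof.
move=> [crX _] /infinite_ge_aleph1 kinf.
have [psi_ub psi_min] := cardsupP (@pseudocharacter_at (Cspace R kappa X)).
apply/card_eqPle; split.
  by apply: psi_min => f; exact: card_pseudocharacter_at_le.
(* The lower bound holds at every point, so a single one, the zero function, bounds the supremum
   from below. *)
pose f : continuousType X R := mkcts (@cst_continuous X R 0%R).
exact: card_le_trans (@card_ac_le R X kappa kinf f crX) (psi_ub f).
Qed.
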